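(* For every $n>3$ and every Steiner triple system $S$ on $n$ vertices, $$\mathrm{mc}_3(S)\leq n-\alpha_3^*(S)\leq n-\frac{0.417}{3}\sqrt{n\log n}.$$
   Context: A Steiner triple system is a $3$-uniform hypergraph in which each pair of distinct vertices is contained in exactly one edge. Here $\log$ is the natural logarithm. The shadow-graph $H^{(2)}$ of a hypergraph $H$ is the graph on $V(H)$ in which $\{x,y\}$ is an edge if and only if some $e\in E(H)$ satisfies $\{x,y\}\subseteq e$. $H$ is connected if $H^{(2)}$ is connected, and the components of $H$ are its maximal connected subgraphs (so an isolated vertex is a component on one vertex). An $r$-coloring of $H$ is a partition $\{E_1,\dots,E_r\}$ of $E(H)$ in which some of the sets may be empty. A monochromatic component of $H$ (with respect to this coloring) is a component of the hypergraph $(V(H),E_i)$ for some $i\in\{1,\dots,r\}$. $\mathrm{mc}_r(H)$ is the largest integer $m$ such that in every $r$-coloring of the edges of $H$ there is a monochromatic component on at least $m$ vertices. $\alpha_3^*(H)$ is the maximum integer $a$ such that there exist pairwise disjoint sets $X_1,X_2,X_3\subseteq V(H)$ with $|X_1|=|X_2|=|X_3|=a$ such that for every $e\in E(H)$ there is $i\in\{1,2,3\}$ with $e\cap X_i=\emptyset$. *)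

(* Defs.v *)
From mathcomp Require Import all_boot all_order all_algebra.
From mathcomp Require Import reals exp.

Set Implicit Arguments.
Unset Strict Implicit.
Unset Printing Implicit Defensive.

Section Hypergraphs.
Variable T : finType.

(* A finite hypergraph with vertices taken in the ambient type T: the pair of
   its vertex set and its edge set. [wf_hypergraph] requires every edge to
   consist of vertices. *)
Definition hypergraph : Type := ({set T} * {set {set T}})%type.

Implicit Types (H K : hypergraph) (X e : {set T}).

Definition vertices H : {set T} := H.1.
Definition edges H : {set {set T}} := H.2.

Definition wf_hypergraph H : bool := [forall e in edges H, e \subset vertices H].

Definition steiner_triple_system H : Prop :=
  [/\ wf_hypergraph H,
      forall e, e \in edges H -> #|e| = 3
    & forall x y, x \in vertices H -> y \in vertices H -> x != y ->
        exists! e, e \in edges H /\ [set x; y] \subset e].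

Definition shadow H : rel T :=
  [rel x y | (x != y) && [exists e in edges H, [set x; y] \subset e]].

Definition hconnected H : bool :=
  (vertices H != set0) &&
  [forall x in vertices H, forall y in vertices H, connect (shadow H) x y].

Definition subhypergraph K H : bool :=
  [&& wf_hypergraph K, vertices K \subset vertices H & edges K \subset edges H].

Definition component H K : bool :=
  [&& subhypergraph K H, hconnected K
    & [forall K' : {set T} * {set {set T}},
        [&& subhypergraph K' H, hconnected K' & subhypergraph K K'] ==>
        (K' == K)]].

(* The classes are indexed by 'I_r, so that some of them may be empty. *)
Definition coloring (r : nat) H (E : {ffun 'I_r -> {set {set T}}}) : bool :=
  (\bigcup_(i < r) E i == edges H) &&
  [forall i, forall j, (i != j) ==> [disjoint E i & E j]].

Definition mono_component (r : nat) H (E : {ffun 'I_r -> {set {set T}}}) K : bool :=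
  [exists i, component (vertices H, E i) K].

(* For 0 < r and a nonempty H, bounding m by the number of vertices loses
   nothing: a coloring exists and no component has more vertices. *)
Definition mc (r : nat) H : nat :=
  \max_(m < #|vertices H|.+1 |
      [forall E : {ffun 'I_r -> {set {set T}}}, coloring H E ==>
        [exists K : {set T} * {set {set T}},
          mono_component H E K && (m <= #|vertices K|)]]) m.

(* Here too the bound on a is harmless, as X1 is a set of vertices. *)
Definition alpha3_star H : nat :=
  \max_(a < #|vertices H|.+1 |
      [exists X1 : {set T}, exists X2 : {set T}, exists X3 : {set T},
        [&& [&& X1 \subset vertices H, X2 \subset vertices H
              & X3 \subset vertices H],
            [&& [disjoint X1 & X2], [disjoint X1 & X3] & [disjoint X2 & X3]],
            [&& #|X1| == a, #|X2| == a & #|X3| == a]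
          & [forall e in edges H,
              [|| e :&: X1 == set0, e :&: X2 == set0 | e :&: X3 == set0]]]]) a.

End Hypergraphs.

(* Main.v *)
Require Import Defs.
From mathcomp Require Import all_boot all_order all_algebra.
From mathcomp Require Import reals exp.
From mathcomp Require Import sequences ring lra zify.

(* Upper bound on mc_3: given X_1, X_2, X_3 realising alpha_3^*, colour an edge
   with some i for which it misses X_i; in colour i the vertices of X_i are
   isolated, so a component is a single vertex or avoids X_i.

   Lower bound on alpha_3^*: fix any X_1 of a vertices and join two other
   vertices v, y when the edge through them meets X_1. Each v determines one
   edge with each x in X_1, so this graph on n - a vertices has maximum degree
   at most a. Choosing the a vertices of X_2 one at a time, always the one that
   dominates the fewest surviving vertices, leaves at least
   (n - a) (1 - (a + 1) / (n - 2a + 1))^a ~ n exp (- a^2 / n) vertices neither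
   in X_2 nor adjacent to it. For a about (0.417 / 3) sqrt (n log n) this is a
   power of n with exponent close to 0.98, well above a, so X_3 can be chosen
   among them. *)

Set Implicit Arguments.
Unset Strict Implicit.
Unset Printing Implicit Defensive.

Import Order.TTheory GRing.Theory Num.Theory.
Local Open Scope ring_scope.

(** * Numerical estimates for the size a *)

Section Numeric.
Variable R : realType.
Implicit Types x y : R.

Lemma ln_le_subr1 x : 0 < x -> ln x <= x - 1.
Proof. by move=> x0; have := @le_ln1Dx R (x - 1); rewrite subrKC; apply; lra. Qed.

(** The inverse of 1 - x/y is 1 + x/(y - x), which is at most exp(x/(y - x)). *)
Lemma expRN_le_onem x y : 0 < y -> x < y -> expR (- (x / (y - x))) <= 1 - x / y.
Proof.
move=> y0 xy.
have yx0 : 0 < y - x by lra.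
have xy1 : 0 < 1 - x / y by rewrite subr_gt0 ltr_pdivrMr // mul1r.
rewrite expRN -[leRHS]invrK lef_pV2 ?posrE ?expR_gt0 ?invr_gt0 //.
suff -> : (1 - x / y)^-1 = 1 + x / (y - x) by exact: expR_ge1Dx.
by field; rewrite !gt_eqF //=; lra.
Qed.

(** Reduces the greedy bound to a logarithmic condition: [expRN_le_onem] with x = a + 1 and y = n -
    2a + 1, so that y - x = n - 3a, is raised to the power a. *)
Lemma size_bound_exp (n a : nat) : (0 < a)%N -> (3 * a < n)%N ->
  (a * a.+1)%:R / (n - 3 * a)%:R <= ln ((n - a)%:R / a%:R) :> R ->
  a%:R <= (n - a)%:R * (1 - a.+1%:R / (n - (2 * a).-1)%:R) ^+ a :> R.
Proof.
move=> a0 an H.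
have A0 : 0 < a%:R :> R by rewrite ltr0n.
have B0 : 0 < (n - a)%:R / a%:R :> R by rewrite divr_gt0 ?ltr0n //; lia.
have H1 : expR (- (a.+1%:R / (n - 3 * a)%:R)) <=
          1 - a.+1%:R / (n - (2 * a).-1)%:R :> R.
  have -> : (n - 3 * a = n - (2 * a).-1 - a.+1)%N by lia.
  by rewrite natrB; [apply: expRN_le_onem; rewrite ?ltr0n ?ltr_nat; lia|lia].
have H2 : a%:R / (n - a)%:R <= expR (- (a.+1%:R / (n - 3 * a)%:R)) ^+ a :> R.
  rewrite -expRM_natl -[leLHS]invrK invf_div -[_ / _ in leLHS]lnK ?posrE //.
  rewrite -expRN ler_expR mulrN lerN2.
  by rewrite mulrA -natrM.
have := lerXn2r a (expR_ge0 _) (le_trans (expR_ge0 _) H1) H1.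
move/(le_trans H2); rewrite ler_pdivrMr ?ltr0n; last by lia.
by rewrite mulrC.
Qed.

(* To be read with [s] the fourth root of [n]. The bound [ln s <= s - 1] then
   gives [t <= 0.139 s^3], so that [n / a] exceeds [3 s + 1]. *)
Lemma size_estimates (s t a : R) : 2 <= s -> 0 <= t -> 0 < a ->
  t ^+ 2 = (139 / 1000) ^+ 2 * (s ^+ 4 * ln (s ^+ 4)) -> t <= a <= t + 1 ->
  3 * a < s ^+ 4 /\
  a * (a + 1) / (s ^+ 4 - 3 * a) <= ln ((s ^+ 4 - a) / a).
Proof.
move=> s2 t0 a0 t2 /andP[ta at1].
have s0 : 0 < s by lra.
have lns0 : 0 <= ln s by rewrite ln_ge0 //; lra.
have ls1 := ln_le_subr1 s0.
have s3 : 8 <= s ^+ 3.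
  have -> : 8 = 2 ^+ 3 :> R by ring.
  by rewrite lerXn2r // nnegrE ltW.
have s4 : 2 * s ^+ 3 <= s ^+ 4 by rewrite (exprS s 3) ler_wpM2r // ltW ?exprn_gt0.
rewrite lnXn // -[ln s *+ 4]mulr_natl in t2.
have ts : t <= 139 / 1000 * s ^+ 3.
  rewrite -(@ler_pXn2r _ 2) ?nnegrE //; last lra.
  rewrite t2 [leRHS]exprMn ler_wpM2l ?sqr_ge0 //.
  have -> : s ^+ 3 ^+ 2 = s ^+ 4 * s ^+ 2 by rewrite -exprM -exprD.
  rewrite ler_wpM2l //; first by rewrite exprn_ge0 ?ltW.
  by have := sqr_ge0 (s - 2); lra.
(* Here 0.264 = 0.139 + 1/8, since 1 <= s^3 / 8. *)
have as3 : a <= 264 / 1000 * s ^+ 3 by lra.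
have a4 : a <= 132 / 1000 * s ^+ 4 by lra.
have s4_0 : 0 < s ^+ 4 by lra.
split; first by lra.
(* The term 334/1000 comes from 3t <= 0.2085 s^4 and 2 <= 0.125 s^4. *)
have aa : a * (a + 1) <= (4 * (139 / 1000) ^+ 2 * ln s + 334 / 1000) * s ^+ 4.
  apply: (le_trans (y := (t + 1) * (t + 2))); first by apply: ler_pM; lra.
  have -> : (t + 1) * (t + 2) = t ^+ 2 + 3 * t + 2 by ring.
  by rewrite t2; lra.
(* The denominator is at least 0.6 s^4, and 57/100 lies between 0.334 / 0.6 and the lower bound 2/3
   for ln 3. *)
apply: (le_trans (y := ln s + 57 / 100)).
  rewrite ler_pdivrMr; last lra.
  apply: (le_trans aa).
  apply: (le_trans (y := (ln s + 57 / 100) * (6 / 10 * s ^+ 4))).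
    by rewrite [leRHS]mulrA ler_wpM2r ?(ltW s4_0) //; lra.
  by rewrite ler_wpM2l //; lra.
apply: (le_trans (y := ln (3 * s))).
  have /ln_le_subr1 : 0 < 3^-1 :> R by lra.
  by rewrite lnV ?lnM ?posrE //; lra.
rewrite ler_ln ?posrE; [|lra|by rewrite divr_gt0 //; lra].
rewrite ler_pdivlMr //.
have := ler_wpM2l (ltW s0) as3.
rewrite mulrCA -exprS.
lra.
Qed.

Lemma size_threshold (n : nat) : (3 < n)%N ->
  exists a : nat, [/\ (0 < a)%N, (3 * a <= n)%N,
    417%:R / 1000%:R / 3%:R * Num.sqrt (n%:R * ln n%:R) <= a%:R :> R
  & a%:R <= (n - a)%:R * (1 - a.+1%:R / (n - (2 * a).-1)%:R) ^+ a :> R].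
Proof.
move=> n3; have n0 : 0 < n%:R :> R by rewrite ltr0n; lia.
set t := _ * Num.sqrt _.
have t0 : 0 <= t by rewrite mulr_ge0 ?sqrtr_ge0 //; lra.
have t2 : t ^+ 2 = (139 / 1000) ^+ 2 * (n%:R * ln n%:R).
  rewrite exprMn sqr_sqrtr; last by rewrite mulr_ge0 ?ler0n // ln_ge0 // ler1n; lia.
  by congr (_ * _); field.
(* Size 1 suffices below 16; from 16 on, the fourth root of n is at least 2. *)
have [n16|n16] := ltnP n 16.
  exists 1%N; split=> //; first by lia.
  - have L : ln n%:R <= 10 / 3 :> R.
      (* [n <= 15 < 16 = (4/3 * 3/2)^4] and [ln x <= x - 1] at [4/3] and [3/2] *)
      apply: (@le_trans _ _ (ln ((4 / 3 * (3 / 2)) ^+ 4))).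
        rewrite ler_ln ?posrE //; last lra.
        have : n%:R <= 15 :> R by rewrite ler_nat; lia.
        by lra.
      rewrite lnXn; last lra.
      rewrite lnM ?posrE; try lra.
      have := @ln_le_subr1 (4 / 3); have := @ln_le_subr1 (3 / 2).
      by rewrite -mulr_natl; lra.
    have N : n%:R <= 15 :> R by rewrite ler_nat; lia.
    have : t ^+ 2 <= 1.
      have : n%:R * ln n%:R <= 15 * (10 / 3) :> R.
        by apply: ler_pM => //; rewrite ?ler0n // ln_ge0 // ler1n; lia.
      by rewrite t2; lra.
    by rewrite expr_le1.
  (* For a = 1 the right-hand side equals n - 3. *)
  - rewrite expr1; have -> : (n - (2 * 1).-1 = n - 1)%N by lia.
    rewrite natrB; last by lia.
    have : 4 <= n%:R :> R by rewrite ler_nat.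
    have N0 : (n%:R - 1 != 0 :> R) by apply/eqP; have : 4 <= n%:R :> R; [rewrite ler_nat|lra].
    by rewrite mulrBr mulr1 mulrCA mulfV // mulr1; lra.
pose s : R := Num.sqrt (Num.sqrt n%:R).
have s4 : n%:R = s ^+ 4 :> R by rewrite (exprM s 2 2) !sqr_sqrtr // sqrtr_ge0.
have s2 : 2 <= s.
  by rewrite -(@ler_pXn2r _ 4) ?nnegrE ?sqrtr_ge0 // -s4 -natrX ler_nat.
have [] := @size_estimates s t (Num.truncn t).+1%:R s2 t0 (ltr0Sn _ _) _ _.
- by rewrite -s4.
- by rewrite ltW ?truncnS_gt //= -natr1 lerD2r truncn_le.
move: (Num.truncn t).+1 (ltn0Sn (Num.truncn t)) (truncnS_gt t) => a a0 ta.
rewrite -s4 natr1 -!natrM ltr_nat => an.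
rewrite -!natrB; [|lia..] => bound.
by exists a; split; [| lia | exact: ltW | exact: size_bound_exp].
Qed.
End Numeric.

(** * Finite sets and the greedy choice *)

Lemma subset_of_card (T : finType) (A : {set T}) (k : nat) : (k <= #|A|)%N ->
  exists2 B : {set T}, B \subset A & #|B| = k.
Proof.
case/card_geqP=> s [us ss sA]; exists [set:: s].
  by apply/subsetP=> x; rewrite inE => /sA.
by rewrite cardsE (card_uniqP us).
Qed.

Section Avoiding.
Variables (T : finType) (W : {set T}) (N : T -> {set T}) (d : nat).
Hypothesis degN : {in W, forall v, #|N v :&: W| <= d}%N.

(** Double counting of the pairs (v, y) with v in [U], y in [W :\: Y] and y in [N v]: each v lies in
    at most d of them, and the minimum over y is at most the average. *)
Lemma light_vertex (U Y : {set T}) : U \subset W -> (#|W :&: Y| < #|W|)%N ->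
  exists2 y, y \in W :\: Y &
    (#|[set v in U | y \in N v]| * #|W :\: Y| <= #|U| * d)%N.
Proof.
move=> sUW ltYW.
have /card_gt0P[y0 y0W] : (0 < #|W :\: Y|)%N by rewrite cardsD subn_gt0.
pose k y := #|[set v in U | y \in N v]|.
case: (arg_minnP k y0W) => y yW miny; exists y => //; rewrite -/(k y).
rewrite mulnC -sum_nat_const.
apply: leq_trans (leq_sum _ (fun y' => miny y')) _.
rewrite /k; under eq_bigr do rewrite -sum1dep_card.
rewrite (exchange_big_dep (mem U)) /=; last by move=> i v _ /andP[].
rewrite -sum_nat_const; apply: leq_sum => v vU.
apply: leq_trans (degN (subsetP sUW _ vU)).
rewrite sum1dep_card; apply: subset_leq_card; apply/subsetP => z.
by rewrite !inE; case/and3P => /setDP[-> _] _ ->.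
Qed.

(** Add a vertex from [light_vertex] each time. At least m candidates remain before every choice,
    the last included, so each choice keeps a proportion of at least 1 - d/m of the survivors. *)
Lemma greedy_avoiding (R : realFieldType) (m : nat) : (0 < m)%N -> (d <= m)%N ->
  forall j, (j + m <= #|W|.+1)%N ->
  exists2 Y : {set T}, Y \subset W /\ #|Y| = j &
    #|W|%:R * (1 - d%:R / m%:R) ^+ j <= #|[set v in W | [disjoint N v & Y]]|%:R :> R.
Proof.
move=> m0 dm; elim=> [_|j IHj jm].
  exists set0; first by rewrite sub0set cards0.
  rewrite expr0 mulr1 ler_nat; apply: subset_leq_card; apply/subsetP => v vW.
  by rewrite inE vW disjoint_sym disjoints_subset sub0set.
have [|Y [sYW cY] leU] := IHj; first by lia.
set U := [set v in W | _] in leU.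
have YI : #|W :&: Y| = j by rewrite (setIidPr sYW).
have cWY : (m <= #|W :\: Y|)%N by rewrite cardsD YI; lia.
have [||y yWY light] := @light_vertex U Y.
- by apply/subsetP => v; rewrite inE => /andP[].
- by rewrite YI; lia.
move: yWY; rewrite inE => /andP[yY yW].
exists (y |: Y).
  by rewrite subUset sub1set yW sYW cardsU1 yY cY.
set K := [set v in U | y \in N v] in light.
have -> : [set v in W | [disjoint N v & y |: Y]] = U :\: K.
  apply/setP => v; rewrite !inE -!setI_eq0 setIUr setU_eq0 [_ :&: [set y]]setIC.
  rewrite setI_eq0 disjoints1.
  by case: (v \in W); case: (y \in N v); case: (_ == _).
have sKU : K \subset U by apply/subsetP => v; rewrite inE => /andP[].
rewrite cardsD (setIidPr sKU) natrB ?subset_leq_card //.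
have leK : #|K|%:R <= #|U|%:R * (d%:R / m%:R) :> R.
  rewrite mulrA ler_pdivlMr ?ltr0n // -!natrM ler_nat.
  by apply: leq_trans light; rewrite leq_mul2l cWY orbT.
have q0 : 0 <= 1 - d%:R / m%:R :> R.
  by rewrite subr_ge0 ler_pdivrMr ?ltr0n // mul1r ler_nat.
have := ler_wpM2r q0 leU; rewrite exprSr mulrA => /le_trans; apply.
by rewrite mulrBr mulr1 lerD2l lerN2.
Qed.
End Avoiding.

(** * Steiner triple systems: the lower bound on [alpha3_star] *)

Lemma steiner_edge_unique (T : finType) (S : hypergraph T) : steiner_triple_system S ->
  forall (x y : T) (e f : {set T}), x != y -> e \in edges S -> f \in edges S ->
  [set x; y] \subset e -> [set x; y] \subset f -> e = f.
Proof.
case=> wfS _ uniqS x y e f xy eS fS xye xyf.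
have := subset_trans xye (forall_inP wfS e eS).
rewrite subUset !sub1set => /andP[xV yV].
have [] := uniqS x y xV yV xy.
by move=> g [_ gE]; rewrite -(gE e) // -(gE f).
Qed.

Section Steiner.
Variables (T : finType) (S : hypergraph T).
Hypothesis hS : steiner_triple_system S.

(* [y = v] is included so that a vertex set avoiding all neighbourhoods
   is in particular disjoint from the set it avoids. *)
Definition through (X : {set T}) (v : T) : {set T} :=
  [set y | (y == v) || [exists e in edges S, [&& v \in e, y \in e & e :&: X != set0]]].

(** Each x in [X] lies in at most one edge with v, whose third vertex is all that x can contribute;
    the successor accounts for v itself. *)
Lemma card_through (X : {set T}) (v : T) : v \notin X ->
  (#|through X v :&: ~: X| <= #|X|.+1)%N.
Proof.
move=> vX.
pose third x y := [exists e in edges S, [&& x \in e, v \in e & y \in e]].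
pose F x := [set y | third x y & (y != v) && (y != x)].
have F1 x : x \in X -> (#|F x| <= 1)%N.
  move=> xX; have xv : x != v by apply: contraNneq vX => <-.
  apply/card_le1_eqP => y z; rewrite !inE.
  case/and3P => /exists_inP[e eS /and3P[xe ve ye]] yv yx.
  case/and3P => /exists_inP[f fS /and3P[xf vf zf]] zv zx.
  have fe : f = e.
    by apply: (steiner_edge_unique hS xv) => //; rewrite subUset !sub1set ?xe ?xf.
  subst f; apply/eqP; apply: contraT => yz.
  have : (3 < #|e|)%N; last by case: hS => _ /(_ e eS) ->.
  apply/card_geqP; exists [:: x; v; y; z]; split=> //.
    rewrite /= !inE !negb_or xv [y == z]eq_sym yz.
    by rewrite ![x == _]eq_sym ![v == _]eq_sym yx zx yv zv.
  by apply/allP; rewrite /= xe ve ye zf.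
have sub : through X v :&: ~: X \subset v |: \bigcup_(x in X) F x.
  apply/subsetP => y; rewrite !inE => /andP[/orP[->//|] + yX].
  case/exists_inP => e eS /and3P[ve ye /set0Pn[x]]; rewrite inE => /andP[xe xX].
  have [//|yv /=] := eqVneq y v; apply/bigcupP; exists x => //; rewrite inE yv.
  apply/andP; split; last by apply: contraNneq yX => ->.
  by apply/exists_inP; exists e => //; rewrite xe ve.
apply: leq_trans (subset_leq_card sub) _.
apply: leq_trans (leq_card_setU _ _).1 _; rewrite cards1 add1n ltnS.
rewrite -[X in (_ <= X)%N]muln1 -sum_nat_const.
elim/big_rec2: _ => [|x k B xX le]; first by rewrite cards0.
by apply: leq_trans (leq_card_setU _ _).1 _; apply: leq_add => //; apply: F1.
Qed.

Lemma alpha3_star_ge (R : realType) (a : nat) : (0 < a)%N ->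
  (3 * a <= #|vertices S|)%N ->
  a%:R <= (#|vertices S| - a)%:R *
     (1 - a.+1%:R / (#|vertices S| - (2 * a).-1)%:R) ^+ a :> R ->
  (a <= alpha3_star S)%N.
Proof.
set V := vertices S => a0 aV bound.
have [|X1 sX1 cX1] := @subset_of_card _ V a; first by lia.
pose W := V :\: X1.
have cW : #|W| = (#|V| - a)%N by rewrite cardsD (setIidPr sX1) cX1.
have degW : {in W, forall v, #|through X1 v :&: W| <= a.+1}%N.
  move=> v; rewrite inE => /andP[vX1 _]; rewrite -cX1.
  apply: leq_trans (card_through vX1); apply: subset_leq_card.
  by apply: setIS; rewrite /W setDE subsetIr.
(* This [m] is |W| - (a - 1), the number of candidates left at the last choice. *)
have [||| Y [sYW cY] leU] := greedy_avoiding degW R (m := (#|V| - (2 * a).-1)%N) _ _ (j := a).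
- lia.
- lia.
- rewrite cW; lia.
have [|Z sZU cZ] := @subset_of_card _ [set v in W | [disjoint through X1 v & Y]] a.
  by rewrite -(ler_nat R); apply: le_trans leU; rewrite cW.
have aV1 : (a < #|V|.+1)%N by lia.
apply: leq_trans (leq_bigmax_cond (Ordinal aV1) _) => //=.
have ZP z : z \in Z -> z \in W /\ [disjoint through X1 z & Y].
  by move/(subsetP sZU); rewrite inE => /andP.
have sZW : Z \subset W by apply/subsetP => z /ZP[].
have sWV : W \subset V by apply: subsetDl.
have dW : [disjoint X1 & W].
  by rewrite -setI_eq0 /W setIDA setDE setIAC setICr set0I.
apply/existsP; exists X1; apply/existsP; exists Y; apply/existsP; exists Z.
rewrite sX1 (subset_trans sYW sWV) (subset_trans sZW sWV) cX1 cY cZ eqxx /=.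
rewrite !(disjointWr _ dW) //=; apply/andP; split.
  rewrite disjoint_sym disjoints_subset; apply/subsetP => z /ZP[_ dz].
  by rewrite inE (disjointFr dz) // inE eqxx.
(* An edge meeting [X1] and containing y in [Y] and z in [Z] would put y in [through X1 z]. *)
apply/forall_inP => e eS; apply: contraT; rewrite !negb_or.
case/and3P => eX1 /set0Pn[y /setIP[ye yY]] /set0Pn[z /setIP[ze /ZP[_ /disjointFl/(_ yY)]]].
rewrite inE => /norP[_ /exists_inP[]]; exists e => //.
by rewrite ze ye.
Qed.

End Steiner.

(** * Colorings: the upper bound on [mc] *)

(** A vertex of [X] has no shadow neighbour, so a connected [K] containing one is a single
    vertex. *)
Lemma mono_component_avoid (T : finType) (V : {set T}) (E : {set {set T}})
    (X : {set T}) (K : hypergraph T) :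
  (forall e, e \in E -> e :&: X = set0) -> component (V, E) K ->
  (#|vertices K| <= maxn 1 #|V :\: X|)%N.
Proof.
move=> avoid /and3P[/and3P[_ sKV sKE] /andP[_ conK] _].
have [KX|] := boolP [disjoint vertices K & X].
  apply: leq_trans (leq_maxr _ _); apply: subset_leq_card.
  by rewrite subsetD sKV.
rewrite -setI_eq0 => /set0Pn[x /setIP[xK xX]].
apply: leq_trans (leq_maxl _ _).
suff -> : vertices K = [set x] by rewrite cards1.
apply/eqP; rewrite eqEsubset sub1set xK andbT; apply/subsetP => y yK.
have /forall_inP/(_ y yK)/connectP[p] := forall_inP conK x xK.
case: p => [_ ->|z p /= /andP[/andP[_ /exists_inP[e eK xze]] _] _]; first by rewrite inE.
have /avoid/setP/(_ x) := subsetP sKE _ eK.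
by rewrite !inE xX (subsetP xze) // !inE eqxx.
Qed.

Lemma alpha3_starP (T : finType) (H : hypergraph T) :
  exists X : 'I_3 -> {set T},
    [/\ forall i, X i \subset vertices H,
        forall i, #|X i| = alpha3_star H,
        (3 * alpha3_star H <= #|vertices H|)%N
      & forall e, e \in edges H -> exists i, e :&: X i == set0].
Proof.
pose Q a := exists X : 'I_3 -> {set T},
  [/\ forall i, X i \subset vertices H, forall i, #|X i| = a,
      (3 * a <= #|vertices H|)%N
    & forall e, e \in edges H -> exists i, e :&: X i == set0].
(* [Q] holds at 0 by empty sets and passes to the larger of two values, hence to the whole
   maximum. *)
rewrite -/(Q (alpha3_star H)); apply: (big_ind Q).
- exists (fun=> set0); split=> // [i|i|e _]; rewrite ?sub0set ?cards0 //.
  by exists ord0; rewrite setI0.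
- by move=> a b Qa Qb; rewrite /maxn; case: ifP.
move=> a /existsP[X1 /existsP[X2 /existsP[X3]]].
case/and4P => /and3P[s1 s2 s3] /and3P[d12 d13 d23] /and3P[/eqP c1 /eqP c2 /eqP c3] avoid.
exists (tnth [tuple X1; X2; X3]); split.
- by case=> [[|[|[]]]].
- by case=> [[|[|[]]]].
- have : (#|X1 :|: (X2 :|: X3)| <= #|vertices H|)%N.
    by rewrite subset_leq_card // !subUset s1 s2.
  rewrite !cardsU (disjoint_setI0 d23) setIUr (disjoint_setI0 d12) (disjoint_setI0 d13).
  by rewrite setU0 cards0 c1 c2 c3; lia.
- move=> e /(forall_inP avoid)/or3P[] ?.
  + by exists (inord 0); rewrite (tnth_nth set0) inordK.
  + by exists (inord 1); rewrite (tnth_nth set0) inordK.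
  + by exists (inord 2); rewrite (tnth_nth set0) inordK.
Qed.

Lemma mc3_le (T : finType) (H : hypergraph T) : (0 < #|vertices H|)%N ->
  (mc 3 H + alpha3_star H <= #|vertices H|)%N.
Proof.
move=> V0; have [X [sX cX aV avoid]] := alpha3_starP H.
suff : (mc 3 H <= #|vertices H| - alpha3_star H)%N by lia.
apply/bigmax_leqP => m /forallP big.
(* The default [ord0] is never reached on an edge, by [avoid]. *)
pose c (e : {set T}) : 'I_3 := odflt ord0 [pick i | e :&: X i == set0].
pose E := [ffun i => [set e in edges H | c e == i]].
have cP e : e \in edges H -> e :&: X (c e) = set0.
  by rewrite /c => /avoid[i Xi]; case: pickP => [j /eqP//|/(_ i)]; rewrite Xi.
have colE : coloring H E.
  apply/andP; split.
    apply/eqP/setP => e; apply/bigcupP/idP => [[i _]|eH].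
      by rewrite ffunE inE => /andP[].
    by exists (c e); rewrite // ffunE inE eH eqxx.
  apply/forallP => i; apply/forallP => j; apply/implyP => ij.
  rewrite -setI_eq0 !ffunE; apply/eqP/setP => e; rewrite !inE.
  by apply/negP => /andP[/andP[_ /eqP ci] /andP[_ /eqP cj]]; rewrite -ci cj eqxx in ij.
have /existsP[K /andP[/existsP[i compK] mK]] := implyP (big E) colE.
apply: leq_trans mK _.
have : (#|vertices K| <= maxn 1 #|vertices H :\: X i|)%N.
  apply: mono_component_avoid compK => e; rewrite ffunE inE => /andP[eH /eqP <-].
  exact: cP.
(* By [aV] and [V0] the difference is at least 1, which absorbs the 1 in [maxn]. *)
by rewrite cardsD (setIidPr (sX i)) cX; lia.
Qed.

Theorem corollary2p1 (R : realType) (T : finType) (S : hypergraph T) (n : nat)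
    (hn : (3 < n)%N) (hS : steiner_triple_system S) (hV : #|vertices S| = n) :
  (mc 3 S)%:R <= n%:R - (alpha3_star S)%:R :> R /\
  n%:R - (alpha3_star S)%:R <=
    n%:R - 417%:R / 1000%:R / 3%:R * Num.sqrt (n%:R * ln n%:R) :> R.
Proof.
have mcn : (mc 3 S + alpha3_star S <= n)%N by rewrite -hV mc3_le // hV; lia.
have [a [a0 an ta bound]] := size_threshold R hn.
have aS : (a <= alpha3_star S)%N by apply: (@alpha3_star_ge _ _ hS R); rewrite ?hV.
split; first by rewrite -natrB ?ler_nat; lia.
by rewrite lerD2l lerN2 (le_trans ta) // ler_nat.
Qed.
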